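(* Let $h,\ell$ be integers with $\ell\ge 3$ and $h\ge 2$, and let $n$ be a positive integer. Suppose $D=\{g_1,\dots,g_h\}\subseteq\mathbb{Z}_n$ has the property that the $h\ell$ values $|jg_i|_n$, for $i\in\{1,\dots,h\}$ and $j\in\{1,\dots,\ell\}$, are pairwise distinct. For each $i$, let $\mathcal{F}_i$ be the family consisting of $i$ copies of $\mathrm{AP}_n(g_i,\ell)$ together with $h-i$ copies of $\mathrm{AP}_n(g_i,\ell+1)$. Then $\mathcal{F}=\bigcup_{i=1}^h\mathcal{F}_i$ (union of families, counting copies) is an Erdős-deep family of $s=h^2$ sets whose distance multiset $\Delta\mathcal{F}$ has $\binom{k}{2}$ elements, where $k=h\ell$.
   Context: For $x\in\mathbb{Z}_n$, $|x|_n:=\min(x,-x)$ with $\pm x$ reduced into $\{0,\dots,n-1\}$, and $\mathrm{dist}(x,y)=|x-y|_n$. For $A\subseteq\mathbb{Z}_n$, $\Delta A$ is the multiset of $\mathrm{dist}(x,y)$ over unordered pairs $\{x,y\}\subseteq A$ with $x\neq y$; for a family $\mathcal{F}$ of subsets (repetitions allowed), $\Delta\mathcal{F}$ is the multiset union of $\Delta A$ over the members $A$ of $\mathcal{F}$, counted with repetition. $\mathcal{F}$ is Erdős-deep if the multiplicities of the distinct values in $\Delta\mathcal{F}$ are exactly $1,2,\dots,k-1$ for some integer $k$. $\mathrm{AP}_n(g,m):=\{0,g,2g,\dots,(m-1)g\}\subseteq\mathbb{Z}_n$. *)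

(* Defs.v *)
From mathcomp Require Import all_boot all_algebra.

Set Implicit Arguments.
Unset Strict Implicit.
Unset Printing Implicit Defensive.

(* Z/nZ for n > 0, including n = 1: for n = m.+1 this is 'I_m.+1 with the
   addition modulo m.+1 of zmodp ('Z_n would be Z/2Z when n = 1). *)
Notation Zmod n := 'I_n.-1.+1 (only parsing).

Section CyclicDistances.

Variable n : nat.
Implicit Types (x y g : Zmod n) (A : {set Zmod n}) (F : seq {set Zmod n}).

Definition cabs x : nat := minn x (- x)%R.

Definition dist x y : nat := cabs (x - y)%R.

(* Multisets are represented by sequences, whose order is irrelevant; an
   unordered pair {x, y} with x != y is represented by (x, y) with x < y. *)
Definition Delta A : seq nat :=
  [seq dist p.1 p.2 | p : Zmod n * Zmod n in
     [pred p | [&& p.1 \in A, p.2 \in A & p.1 < p.2]]].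

Definition DeltaF F : seq nat := flatten [seq Delta A | A <- F].

Definition multiplicities (s : seq nat) : seq nat :=
  [seq count_mem d s | d <- undup s].

Definition erdos_deep F : Prop :=
  exists k : nat, perm_eq (multiplicities (DeltaF F)) (iota 1 k.-1).

Definition AP g (m : nat) : {set Zmod n} := [set (g *+ j)%R | j : 'I_m].

(* Indices are shifted: i : 'I_h stands for the index i.+1 in {1, ..., h}, and g i
   for g_(i.+1). *)
Definition AP_family_i (h l : nat) (g : 'I_h -> Zmod n) (i : 'I_h) :
    seq {set Zmod n} :=
  nseq i.+1 (AP (g i) l) ++ nseq (h - i.+1) (AP (g i) l.+1).

Definition AP_family (h l : nat) (g : 'I_h -> Zmod n) : seq {set Zmod n} :=
  flatten [seq AP_family_i l g i | i <- enum 'I_h].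

End CyclicDistances.

(* Main.v *)
Require Import Defs.
From mathcomp Require Import all_boot all_algebra.
From mathcomp Require Import zify.

(** Since [l >= 3], distinctness of the [|j g_i|] forces [j g_i <> 0] for
    [1 <= j <= l], so each progression has as many elements as terms and
    [AP(g_i, m)] contributes the distance [|j g_i|] exactly [m - j] times.
    Altogether [|j g_i|] has multiplicity
    [i (l - j) + (h - i) (l + 1 - j) = h (l + 1 - j) - i], and by Euclidean
    division by [h] these numbers run once through [0, ..., h l - 1]. *)

Import GRing.Theory.

Lemma cabsN n (x : Zmod n) : cabs (- x)%R = cabs x.
Proof. by rewrite /cabs opprK minnC. Qed.

Lemma dist_sym n (x y : Zmod n) : dist x y = dist y x.
Proof. by rewrite /dist -cabsN opprB. Qed.

(** Swapping coordinates matches the pairs with [p.2 < p.1] to those with [p.1 < p.2]. *)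
Lemma sum_neq_ord_pairs m (P : pred ('I_m * 'I_m)) (F : 'I_m * 'I_m -> nat) :
    (forall a b, P (a, b) = P (b, a)) -> (forall a b, F (a, b) = F (b, a)) ->
  \sum_(p | P p && (p.1 != p.2)) F p = 2 * \sum_(p | P p && (p.1 < p.2)) F p.
Proof.
move=> symP symF; rewrite (bigID (fun p : 'I_m * 'I_m => p.1 < p.2)) /=.
rewrite mul2n -addnn; congr (_ + _).
  by apply: eq_bigl => -[a b] /=; rewrite -val_eqE /=; case: (P _) => //=; lia.
pose swap (p : 'I_m * 'I_m) := (p.2, p.1).
rewrite (reindex_inj (h := swap)) /=; last by move=> [a b] [c d] [-> ->].
apply: eq_big => [[a b]|[a b] _] /=; last exact: symF.
by rewrite symP -val_eqE /=; case: (P _) => //=; lia.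
Qed.

Lemma count_mem_Delta n (A : {set Zmod n}) d :
  count_mem d (Delta A)
  = \sum_(p : Zmod n * Zmod n | (p.1 \in A) && (p.2 \in A) && (p.1 < p.2))
      (dist p.1 p.2 == d).
Proof.
rewrite /Delta -sum1_count big_map big_enum_cond /= big_mkcondr /=.
by apply: eq_big => [p|p _]; rewrite ?inE ?andbA //; case: eqP.
Qed.

(* Counting ordered pairs on both sides avoids comparing the order of residues
   with the order of indices. *)
Lemma count_mem_Delta_imset n m (f : 'I_m -> Zmod n) d : injective f ->
  count_mem d (Delta [set f a | a : 'I_m])
  = \sum_(p : 'I_m * 'I_m | p.1 < p.2) (dist (f p.1) (f p.2) == d).
Proof.
move=> injf; apply/eqP; rewrite -(eqn_pmul2l (isT : 0 < 2)) count_mem_Delta.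
set A := [set _ | _ in _].
rewrite -(sum_neq_ord_pairs _ (fun p => (p.1 \in A) && (p.2 \in A))); first last.
- by move=> x y /=; rewrite dist_sym.
- by move=> x y /=; rewrite andbC.
have := sum_neq_ord_pairs _ xpredT
  (fun p : 'I_m * 'I_m => (dist (f p.1) (f p.2) == d) : nat).
move=> /= <- //; last by move=> a b; rewrite dist_sym.
(* Since [f] is injective, [ff] maps the pairs of distinct indices bijectively onto the pairs of
   distinct elements of [A]. *)
pose ff (p : 'I_m * 'I_m) := (f p.1, f p.2).
have injff : injective ff by move=> [a b] [c e] [/injf -> /injf ->].
rewrite -(big_imset (h := ff) (A := fun p => p.1 != p.2)
  (fun p => (dist p.1 p.2 == d) : nat)) /=; last by move=> ? ? _ _; apply: injff.
apply/eqP; apply: eq_bigl => -[x y] /=; apply/andP/imsetP.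
  case=> /andP [/imsetP [a _ ->] /imsetP [b _ ->]] neq; exists (a, b) => //.
  by rewrite unfold_in /=; apply: contraNneq neq => ->.
case=> -[a b]; rewrite [_ \in _]unfold_in /= => neq [-> ->].
by rewrite (inj_eq injf); split=> //; apply/andP; split; apply: imset_f.
Qed.

(** Exactly [m - j.+1] pairs have difference [j.+1]. The bound on [m] keeps every difference at most
    [l], and truncated subtraction cancels the differences that do not occur. *)
Lemma sum_ord_differences m l (G : nat -> nat) : m <= l.+1 ->
  \sum_(p : 'I_m * 'I_m | p.1 < p.2) G (p.2 - p.1)
  = \sum_(j < l) (m - j.+1) * G j.+1.
Proof.
move=> le_ml.
transitivity (\sum_(a < m) \sum_(b < m | a < b) G (b - a)).
  by rewrite pair_big_dep.
rewrite (exchange_big_dep xpredT) //=.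
transitivity (\sum_(b < m) \sum_(j < l | j < b) G j.+1).
  apply: eq_bigr => b _.
  rewrite -(big_ord_widen _ (fun a => G (b - a)) (ltnW (ltn_ord b))).
  rewrite -(big_ord_widen l (fun j => G j.+1)); last by have := ltn_ord b; lia.
  (* Reversal sends [a] to [b - a.+1], which turns the difference [b - a] into [a.+1]. *)
  rewrite (reindex_inj rev_ord_inj) /=; apply: eq_bigr => a _.
  by congr G; have := ltn_ord a; lia.
rewrite (exchange_big_dep xpredT) //=; apply: eq_bigr => j _.
rewrite sum_nat_const; congr (_ * _).
rewrite -sum1_card -(big_mkord (fun b => j < b) (fun=> 1)).
elim: m {le_ml} => [|m IHm]; first by rewrite big_nil.
by rewrite big_mkcond big_nat_recr //= -big_mkcond IHm; case: ltnP; lia.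
Qed.

Lemma count_mem_Delta_AP n (g : Zmod n) l m d : m <= l.+1 ->
    (forall j, 0 < j <= l -> (g *+ j)%R <> 0%R) ->
  count_mem d (Delta (AP g m))
  = \sum_(j < l) (m - j.+1) * (cabs (g *+ j.+1)%R == d).
Proof.
move=> le_ml nz.
have lt_neq (a b : 'I_m) : a < b -> (g *+ a)%R <> (g *+ b)%R.
  move=> ltab eqab; apply: (nz (b - a)); first by have := ltn_ord b; lia.
  by rewrite mulrnBr 1?ltnW // eqab subrr.
rewrite /AP count_mem_Delta_imset; last first.
  move=> a b eqab; apply: val_inj.
  case: (ltngtP a b) => // /lt_neq; first by rewrite eqab.
  by rewrite eqab.
rewrite -(sum_ord_differences m l (fun j => (cabs (g *+ j)%R == d) : nat)) //.
by apply: eq_bigr => -[a b] /= ltab; rewrite mulrnBr 1?ltnW // dist_sym.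
Qed.

(** If [j g = 0] with [j < l], then [(j + 1) g = g] collides with the multiple of index 1. If
    [l g = 0], then [(l - 1) g = - g] has the same absolute value as [g], a collision because
    [3 <= l] gives [l - 1 <> 1]. *)
Lemma mulrn_neq0_of_cabs_inj n (g : Zmod n) l : 3 <= l ->
    injective (fun j : 'I_l => cabs (g *+ j.+1)%R) ->
  forall j, 0 < j <= l -> (g *+ j)%R <> 0%R.
Proof.
move=> l_ge3 inj j j_bnd gj0.
have distinct a b : 0 < a <= l -> 0 < b <= l ->
    cabs (g *+ a)%R = cabs (g *+ b)%R -> a = b.
  case: a b => [|a] [|b] // a_lt b_lt eqc.
  by have /(congr1 val) /= -> := inj (Ordinal a_lt) (Ordinal b_lt) eqc.
have [ltjl | lejl] := ltnP j l.
  have := distinct j.+1 1; rewrite mulrS gj0 addr0 => /(_ _ _ erefl); lia.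
have eqj : j = l by lia.
have := distinct l.-1 1.
have -> : (g *+ l.-1 = - g)%R.
  apply/eqP; rewrite -addr_eq0 -mulrSr prednK; last by lia.
  by rewrite -eqj gj0.
rewrite cabsN => /(_ _ _ erefl); lia.
Qed.

(** By injectivity of [c], the value [c p] receives only the weight [w p]; values of weight 0 are
    absent from [s], hence the filter. *)
Lemma multiplicities_perm (T : finType) (c w : T -> nat) s : injective c ->
    (forall d, count_mem d s = \sum_p w p * (c p == d)) ->
  perm_eq (multiplicities s) [seq x <- [seq w p | p <- enum T] | 0 < x].
Proof.
move=> injc cnt.
have cntc p : count_mem (c p) s = w p.
  rewrite cnt (bigD1 p) //= eqxx muln1 big1 ?addn0 // => q neq.
  by rewrite (inj_eq injc) (negPf neq) muln0.
have perm : perm_eq (undup s) [seq c p | p <- enum T & 0 < w p].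
  apply: uniq_perm; first exact: undup_uniq.
    by rewrite map_inj_uniq //; apply/filter_uniq/enum_uniq.
  move=> d; rewrite mem_undup -has_pred1 has_count; apply/idP/mapP.
    rewrite cnt lt0n sum_nat_eq0 => /forallPn /= [p].
    rewrite muln_eq0 negb_or eqb0 negbK => /andP [wp /eqP <-].
    by exists p => //; rewrite mem_filter lt0n wp mem_enum.
  by case=> p; rewrite mem_filter => /andP [wp _] ->; rewrite cntc.
apply: perm_trans (perm_map _ perm) _.
rewrite -map_comp filter_map.
by under eq_map => p do rewrite /= cntc.
Qed.

Lemma sumn_multiplicities s : sumn (multiplicities s) = size s.
Proof.
rewrite -[RHS](perm_size (perm_count_undup s)) size_flatten /shape -map_comp.
by congr sumn; apply: eq_map => d /=; rewrite size_nseq.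
Qed.

(** The entry equals [h * (l - 1 - p.2) + (h - 1 - p.1)]: its quotient and remainder by [h] are the
    two indices, each reversed. *)
Lemma perm_mixed_radix h l :
  perm_eq [seq h * (l - p.2) - p.1.+1 | p : 'I_h * 'I_l] (iota 0 (h * l)).
Proof.
have injw : injective (fun p : 'I_h * 'I_l => h * (l - p.2) - p.1.+1).
  move=> [a b] [c d] /= eqw; have := ltn_ord a; have := ltn_ord b.
  have := ltn_ord c; have := ltn_ord d => ? ? ? ?.
  have eqbd : b = d :> nat by nia.
  by congr pair; apply: val_inj => //=; nia.
have uw : uniq [seq h * (l - p.2) - p.1.+1 | p : 'I_h * 'I_l].
  by rewrite map_inj_uniq ?enum_uniq.
apply: uniq_perm; rewrite ?iota_uniq //.
(* Both lists have [h * l] entries and the first has no repetition, so one inclusion suffices. *)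
apply: (uniq_min_size uw _ _).2.
  move=> x /mapP [[a b] _ ->] /=; rewrite mem_iota /=.
  by have := ltn_ord a; have := ltn_ord b; nia.
by rewrite size_iota size_map -cardT card_prod !card_ord.
Qed.

Lemma size_AP_family n h l (g : 'I_h -> Zmod n) : size (AP_family l g) = h ^ 2.
Proof.
rewrite /AP_family size_flatten /shape -map_comp sumnE big_map big_enum /=.
rewrite (eq_bigr (fun=> h)) ?sum_nat_const ?card_ord ?mulnn // => i _.
by rewrite /AP_family_i /= size_cat !size_nseq -addSn subnKC.
Qed.

Lemma count_mem_DeltaF_AP_family n h l (g : 'I_h -> Zmod n) d :
    (forall i j, 0 < j <= l -> (g i *+ j)%R <> 0%R) ->
  count_mem d (DeltaF (AP_family l g))
  = \sum_(p : 'I_h * 'I_l)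
      (h * (l - p.2) - p.1.+1) * (cabs (g p.1 *+ p.2.+1)%R == d).
Proof.
move=> nz.
have cnt F : count_mem d (DeltaF F) = \sum_(A <- F) count_mem d (Delta A).
  by rewrite /DeltaF count_flatten sumnE !big_map.
rewrite cnt /AP_family big_flatten big_map big_enum /=.
rewrite -(pair_bigA _ (fun (i : 'I_h) (j : 'I_l) =>
  (h * (l - j) - i.+1) * (cabs (g i *+ j.+1)%R == d))) /=.
apply: eq_bigr => i _; rewrite /AP_family_i big_cat !big_nseq !iter_addn_0.
rewrite !(count_mem_Delta_AP _ _ l) ?leqnSn //; try exact: nz.
rewrite !big_distrl /= -big_split; apply: eq_bigr => j _ /=.
case: eqP => _; rewrite ?muln1 ?muln0 //.
by have := ltn_ord i; have := ltn_ord j; nia.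
Qed.

Theorem theorem4p1 (h l n : nat) (hl : 3 <= l) (hh : 2 <= h) (hn : 0 < n)
    (g : 'I_h -> Zmod n)
    (g_distinct : injective
       (fun p : 'I_h * 'I_l => cabs (g p.1 *+ p.2.+1)%R)) :
  [/\ erdos_deep (AP_family l g),
      size (AP_family l g) = h ^ 2
    & size (DeltaF (AP_family l g)) = 'C(h * l, 2)].
Proof.
have nz i j : 0 < j <= l -> (g i *+ j)%R <> 0%R.
  apply: mulrn_neq0_of_cabs_inj => // a b eqc.
  by have [] := g_distinct (i, a) (i, b) eqc.
have deep : perm_eq (multiplicities (DeltaF (AP_family l g)))
                    (iota 1 (h * l).-1).
  apply: perm_trans (multiplicities_perm _ _ _ _ g_distinct _) _.
    by move=> d; rewrite count_mem_DeltaF_AP_family.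
  apply: perm_trans (perm_filter _ (perm_mixed_radix h l)) _.
  have : 0 < h * l by nia.
  (* The filter drops the single multiplicity 0. It belongs to [|l g_h|]: all progressions with step
     [g_h] have only [l] terms. *)
  case: (h * l) => // k _ /=; rewrite (eq_in_filter (a2 := predT)).
    by rewrite filter_predT.
  by move=> x; rewrite mem_iota => /andP [].
split; [by exists (h * l) | exact: size_AP_family |].
(* The size is the sum of the multiplicities, [1 + ... + (h * l - 1)]. *)
rewrite -sumn_multiplicities (perm_sumn deep) sumnE -bin2_sum.
have : 0 < h * l by nia.
by case: (h * l) => // k _; rewrite /index_iota subn0 /= big_cons add0n.
Qed.
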